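(* Fix $\ell_0>0$ and $h_0>0$. There exist $U_0=U_0(\ell_0,d,h_0,t)$ and a function $\varepsilon_{\rm FE}(U,\beta;h_0)\ge 0$ such that, for all $U\ge U_0$, all $\beta>0$ satisfying $\beta J_0(U)\ge \ell_0$, all $L\in 2\mathbb N$ and all $h\in\mathbb R$ with $|h|\le h_0$, \[ \bigl|p^{\rm Hub}_{\Lambda_L,\beta,U}(h)-p^{\rm Heis}_{\Lambda_L,\beta,U}(h)\bigr|\le \varepsilon_{\rm FE}(U,\beta;h_0). \] Moreover, \[ \lim_{U\to\infty}\ \sup_{\beta>0:\ \beta J_0(U)\ge\ell_0}\varepsilon_{\rm FE}(U,\beta;h_0)=0 . \] (The estimate is uniform in $L$ and in $|h|\le h_0$.)
   Context: Fix $d\ge 1$ and $t\in\mathbb R\setminus\{0\}$. For $L\in 2\mathbb N$ let $\Lambda_L=(\mathbb Z/L\mathbb Z)^d$ and let $\mathscr B_{\Lambda_L}$ be the set of unordered nearest-neighbour bonds $\{x,y\}$ of the torus, each counted once. Let $\mathcal H_{\Lambda_L}$ be the fermionic Fock space over $\ell^2(\Lambda_L)\otimes\mathbb C^2$, with operators $c_{x\sigma},c_{x\sigma}^*$ ($x\in\Lambda_L$, $\sigma\in\{\uparrow,\downarrow\}$) satisfying the canonical anticommutation relations. Set $n_{x\sigma}=c_{x\sigma}^*c_{x\sigma}$, $n_x=n_{x\uparrow}+n_{x\downarrow}$, $N_{\Lambda_L}=\sum_x n_x$, and let $\mathcal H^{\rm hf}_{\Lambda_L}=\ker(N_{\Lambda_L}-|\Lambda_L|)$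 (half-filled sector). Let $D_{\Lambda_L}=\sum_x n_{x\uparrow}n_{x\downarrow}$, $T_{\Lambda_L}=-t\sum_{\{x,y\}\in\mathscr B_{\Lambda_L}}\sum_{\sigma}(c_{x\sigma}^*c_{y\sigma}+c_{y\sigma}^*c_{x\sigma})$, $\eta_x=(-1)^{x_1+\dots+x_d}$, $S^{(3)}_x=\tfrac12(n_{x\uparrow}-n_{x\downarrow})$, $M_{\Lambda_L}=\sum_x\eta_xS^{(3)}_x$. For $U>0$, $h\in\mathbb R$, the Hubbard Hamiltonian on $\mathcal H^{\rm hf}_{\Lambda_L}$ is $H^{\rm Hub}_{\Lambda_L}(h)=UD_{\Lambda_L}+T_{\Lambda_L}-hM_{\Lambda_L}$, and for $\beta>0$, $p^{\rm Hub}_{\Lambda_L,\beta,U}(h)=\frac{1}{\beta|\Lambda_L|}\log\operatorname{Tr}_{\mathcal H^{\rm hf}_{\Lambda_L}}e^{-\beta H^{\rm Hub}_{\Lambda_L}(h)}$. Spin side: $\mathcal H^{\rm spin}_{\Lambda_L}=\bigotimes_{x\in\Lambda_L}\mathbb C^2$; $S^{(a)}_x$ ($a=1,2,3$) acts as $\tfrac12\sigma^{(a)}$ (Pauli matrix) on the factor at $x$ and as identity elsewhere; $\mathbf S_x\cdot\mathbf S_y=\sum_a S^{(a)}_xS^{(a)}_y$; $M^{\rm spin}_{\Lambda_L}=\sum_x\eta_xS^{(3)}_x$. For $J>0$, $H^{\rm Heis}_{\Lambda_L}(J,h)=J\sum_{\{x,y\}\in\mathscr B_{\Lambda_L}}(\mathbf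 S_x\cdot\mathbf S_y-\tfrac14)-hM^{\rm spin}_{\Lambda_L}$. Put $J_0(U)=4t^2/U$ and $p^{\rm Heis}_{\Lambda_L,\beta,U}(h)=\frac{1}{\beta|\Lambda_L|}\log\operatorname{Tr}_{\mathcal H^{\rm spin}_{\Lambda_L}}e^{-\beta H^{\rm Heis}_{\Lambda_L}(J_0(U),h)}$. *)

(* Defs.v *)
From HB Require Import structures.
From mathcomp Require Import all_boot all_order all_algebra.
From mathcomp Require Import all_classical all_reals all_analysis.
From mathcomp Require Import complex.

Set Implicit Arguments.
Unset Strict Implicit.
Unset Printing Implicit Defensive.

Import Order.TTheory GRing.Theory Num.Theory.
Import numFieldNormedType.Exports.
Local Open Scope ring_scope.
Local Open Scope complex_scope.

(* Operators on the finite-dimensional Hilbert space spanned by an           *)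
(* orthonormal basis indexed by a finite type B, as matrices 'M[C]_#|B|,     *)
(* where the basis vector b corresponds to index enum_rank b.               *)

Section Operators.
Variable R : realType.
Local Notation C := R[i].

Definition opB (B : finType) := 'M[C]_#|B|.

Definition op_of (B : finType) (f : B -> B -> C) : opB B :=
  \matrix_(i, j) f (enum_val i) (enum_val j).

Definition entry (B : finType) (A : opB B) (x y : B) : C :=
  A (enum_rank x) (enum_rank y).

Definition adjoint (n : nat) (A : 'M[C]_n) : 'M[C]_n :=
  \matrix_(i, j) conjc (A j i).

(* Tr e^{-beta H}, defined by the (absolutely convergent) exponential series
   Tr e^{-beta H} = sum_k (-beta)^k / k! Tr(H^k); for Hermitian H this is real,
   we take the real part of the partial sums. *)
Definition tr_exp (n : nat) (beta : R) (H : 'M[C]_n) : R :=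
  limn (fun m : nat =>
    complex.Re (\sum_(k < m) \tr (H ^+ k) * ((- beta) ^+ k / (k`!)%:R)%:C)).

End Operators.

(* The torus Lambda_L = (Z/LZ)^d  (we always use it with L >= 2, so 'Z_L is  *)
(* exactly Z/LZ).                                                            *)

Definition site (L d : nat) := {ffun 'I_d -> 'Z_L}.

Definition shift (L d : nat) (x : site L d) (i : 'I_d) : site L d :=
  [ffun j => if j == i then x j + 1 else x j].

Definition adjacent (L d : nat) (x y : site L d) : bool :=
  [exists i : 'I_d, (y == shift x i) || (x == shift y i)].

Definition bonds (L d : nat) : {set {set site L d}} :=
  [set b : {set site L d} |
     [exists x : site L d, exists y : site L d, adjacent x y && (b == [set x; y])]].

Definition bond_sum (L d : nat) (V : zmodType) (F : site L d -> site L d -> V) : V :=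
  \sum_(b in bonds L d) \sum_(x in b) \sum_(y in b | (enum_rank x < enum_rank y)%N) F x y.

Definition eta (R : pzRingType) (L d : nat) (x : site L d) : R :=
  (-1) ^+ (\sum_(i < d) (x i : nat))%N.

(* Fermionic Fock space over l^2(Lambda_L) (x) C^2: occupation-number basis  *)
(* indexed by configurations n : mode -> bool, mode = site * spin, spin      *)
(* true = up, false = down.  The c_{x sigma} are given by the standard       *)
(* Jordan-Wigner construction w.r.t. the order enum_rank on modes, so they   *)
(* satisfy the CAR.                                                          *)

Definition mode (L d : nat) := (site L d * bool)%type.
Definition fconfig (L d : nat) := {ffun mode L d -> bool}.

Section Hubbard.
Variable R : realType.
Local Notation C := R[i].
Variables (L d : nat).
Local Notation F := (fconfig L d).

Definition ann (p : mode L d) : opB R F :=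
  op_of (fun (n' n : F) =>
    if n p && (n' == [ffun q => if q == p then false else n q])
    then (-1) ^+ #|[set q : mode L d | (enum_rank q < enum_rank p)%N && n q]|
    else 0).

Definition cre (p : mode L d) : opB R F := adjoint (ann p).

Definition numop (p : mode L d) : opB R F := cre p *m ann p.

Definition Dop : opB R F :=
  \sum_(x : site L d) (numop (x, true) *m numop (x, false)).

Definition Top (t : R) : opB R F :=
  (- t)%:C *: bond_sum (fun x y : site L d =>
     \sum_(s : bool) (cre (x, s) *m ann (y, s) + cre (y, s) *m ann (x, s))).

Definition S3f (x : site L d) : opB R F :=
  (1 / 2 : R)%:C *: (numop (x, true) - numop (x, false)).
Definition Mop : opB R F := \sum_(x : site L d) (eta C x *: S3f x).

Definition H_Hub_full (t U h : R) : opB R F :=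
  U%:C *: Dop + Top t - h%:C *: Mop.

Definition half_filled (n : F) : bool :=
  #|[set p : mode L d | n p]| == #|site L d|.
Definition hfconfig := {n : F | half_filled n}.

(* Hubbard Hamiltonian on the half-filled sector H^hf (N commutes with H,
   so this is the compression of H_Hub_full to H^hf) *)
Definition H_Hub (t U h : R) : opB R hfconfig :=
  op_of (fun n' n : hfconfig => entry (H_Hub_full t U h) (val n') (val n)).

Definition p_Hub (t beta U h : R) : R :=
  (beta * (#|site L d|)%:R)^-1 * ln (tr_exp beta (H_Hub t U h)).

End Hubbard.

(* Spin side: (C^2)^{(x) Lambda}, basis sconfig = site -> bool (true = up). *)

Definition sconfig (L d : nat) := {ffun site L d -> bool}.

Section Heisenberg.
Variable R : realType.
Local Notation C := R[i].
Variables (L d : nat).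
Local Notation S := (sconfig L d).

(* Pauli matrices sigma^(a), a = 1,2,3 (as 'I_3 = 0,1,2), in basis (up, down) *)
Definition pauli (a : 'I_3) (s' s : bool) : C :=
  match nat_of_ord a with
  | 0%N => if s' != s then 1 else 0
  | 1%N => if s' && ~~ s then - 'i%C else if ~~ s' && s then 'i%C else 0
  | _ => if s' == s then (if s then 1 else -1) else 0
  end.

Definition Sop (a : 'I_3) (x : site L d) : opB R S :=
  op_of (fun s' s : S =>
    if [forall y : site L d, (y != x) ==> (s' y == s y)]
    then (1 / 2 : R)%:C * pauli a (s' x) (s x) else 0).

Definition SdotS (x y : site L d) : opB R S :=
  \sum_(a < 3) (Sop a x *m Sop a y).

Definition Mspin : opB R S := \sum_(x : site L d) (eta C x *: Sop 2 x).

Definition H_Heis (J h : R) : opB R S :=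
  J%:C *: bond_sum (fun x y : site L d => SdotS x y - (1 / 4 : R)%:C%:M)
  - h%:C *: Mspin.

Definition J0 (t U : R) : R := 4 * t ^+ 2 / U.

Definition p_Heis (t beta U h : R) : R :=
  (beta * (#|site L d|)%:R)^-1 * ln (tr_exp beta (H_Heis (J0 t U) h)).

End Heisenberg.

(* Main.v *)
Require Import Defs.
From HB Require Import structures.
From mathcomp Require Import all_boot all_order all_algebra.
From mathcomp Require Import all_classical all_reals all_analysis.
From mathcomp Require Import complex.
From mathcomp Require Import spectral sesquilinear ring lra zify.
Import Order.TTheory GRing.Theory Num.Theory.
Import numFieldNormedType.Exports.
Local Open Scope classical_set_scope.
Local Open Scope ring_scope.

(* Both pressures are |h|/2 + O(1/U), uniformly in the volume N. If a Hermitian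
   H on a space of dimension at most 4^N has lowest eigenvalue E, then
   e^(-beta E) <= Tr e^(-beta H) <= 4^N e^(-beta E), so the pressure is -E/N up to
   O(1/beta), which is O(1/U) because beta J0 >= l0. It remains to see that
   E = -|h|N/2 + O(N/U).
   Upper bounds on E: the diagonal matrix element at a Neel configuration whose
   orientation follows the sign of h.
   Lower bounds: the exchange term of the Heisenberg model has norm O(J0 N). For
   the Hubbard model, use Gershgorin's bound with the weights a^(number of doublons),
   a = 8d|t|/U. A hop that creates a doublon and a hole has relative weight a, and
   there are O(dN) of them; every other hop leaves a doublon or fills a hole, and
   at half filling there are as many holes as doublons, so the total of these
   hops is O(d|t|/a) times the number D of doublons and is absorbed by U D. *)

Set Implicit Arguments.
Unset Strict Implicit.
Unset Printing Implicit Defensive.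

(** * Real-valued modulus and real part of complex numbers *)

Section ComplexModulus.
Variable R : realType.
Local Open Scope complex_scope.
Implicit Types z : R[i].

(** The norm on [R[i]] takes its values in [R[i]]; this copy lives in [R], where the bounds are
    compared. *)
Definition cabs z : R := complex.Re `|z|.

Lemma cabsE z : `|z| = (cabs z)%:C.
Proof. by rewrite /cabs RRe_real ?normr_real. Qed.

Lemma cabs_ge0 z : 0 <= cabs z.
Proof. by rewrite -lecR -cabsE; exact: normr_ge0. Qed.

Lemma cabsM z1 z2 : cabs (z1 * z2) = cabs z1 * cabs z2.
Proof. by apply: (@complexI R); rewrite rmorphM -!cabsE normrM. Qed.

Lemma cabsD z1 z2 : cabs (z1 + z2) <= cabs z1 + cabs z2.
Proof. by rewrite -lecR rmorphD -!cabsE; exact: ler_normD. Qed.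

Lemma cabsN z : cabs (- z) = cabs z.
Proof. by rewrite /cabs normrN. Qed.

Lemma cabs0 : cabs 0 = 0.
Proof. by rewrite /cabs normr0. Qed.

Lemma cabs1 : cabs 1 = 1.
Proof. by rewrite /cabs normr1. Qed.

Lemma cabs_sign n : cabs ((-1) ^+ n) = 1.
Proof. by rewrite /cabs normrX normrN1 expr1n. Qed.

Lemma cabs_real (x : R) : cabs x%:C = `|x|.
Proof. by rewrite /cabs normc_def /= expr0n addr0 sqrtr_sqr. Qed.

Lemma cabs_sum I (r : seq I) (P : pred I) (F : I -> R[i]) :
  cabs (\sum_(i <- r | P i) F i) <= \sum_(i <- r | P i) cabs (F i).
Proof.
elim/big_ind2: _ => [|a b c e ab ce|//]; first by rewrite cabs0.
exact: le_trans (cabsD _ _) (lerD ab ce).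
Qed.

Lemma Re_real (x : R) : complex.Re x%:C = x. Proof. by []. Qed.

Lemma Re_sum I (r : seq I) (P : pred I) (F : I -> R[i]) :
  complex.Re (\sum_(i <- r | P i) F i) = \sum_(i <- r | P i) complex.Re (F i).
Proof. by apply: (big_morph _ _ _) => [[a b] [c e]|]. Qed.

Lemma Re_realM (x : R) z : complex.Re (x%:C * z) = x * complex.Re z.
Proof. by case: z => a b; rewrite /= mul0r subr0. Qed.

Lemma ReD z1 z2 : complex.Re (z1 + z2) = complex.Re z1 + complex.Re z2.
Proof. by case: z1 z2 => [a b] [c e]. Qed.

Lemma ReN z : complex.Re (- z) = - complex.Re z.
Proof. by case: z. Qed.

Lemma Re_ge_cabs z : - cabs z <= complex.Re z.
Proof.
suff: `|complex.Re z| <= cabs z by rewrite ler_norml => /andP[].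
by rewrite -lecR -cabsE normc_ge_Re.
Qed.

End ComplexModulus.

(** * Spectral evaluation of [tr_exp] for Hermitian matrices *)

Section Spectral.
Variable R : realType.
Local Open Scope complex_scope.
Local Notation C := R[i].

(** The spectral theorem, phrased with [adjoint] and real eigenvalues. The rows of [P] are left
    eigenvectors of [H], which is why eigenvectors are row vectors from here on. *)
Lemma hermitian_diagonalization n (H : 'M[C]_n) : adjoint H = H ->
  exists (P : 'M[C]_n) (lam : 'I_n -> R),
    [/\ P *m adjoint P = 1%:M, adjoint P *m P = 1%:M &
        H = adjoint P *m diag_mx (\row_i (lam i)%:C) *m P].
Proof.
move=> Hadj; pose P := spectralmx H.
have adjE m (A : 'M[C]_m) : adjoint A = map_mx Num.conj A^T.
  by apply/matrixP => i j; rewrite !mxE.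
have Hh : H \is hermsymmx.
  by apply/is_hermitianmxP; rewrite expr0 scale1r -{1}Hadj adjE.
have Pu := spectral_unitarymx H.
have PP : P *m adjoint P = 1%:M by rewrite adjE; apply/unitarymxP.
(* The entries of [spectral_diag H] are real because [H] is Hermitian, so taking real parts loses
   nothing. *)
exists P, (fun i => complex.Re (spectral_diag H 0 i)); split => //.
  exact: mulmx1C.
have /orthomx_spectralP HE := hermitian_normalmx Hh.
rewrite [LHS]HE (invmx_unitary Pu) (adjE _ P); congr (_ *m diag_mx _ *m _).
apply/rowP => i; rewrite mxE RRe_real //.
by have /mxOverP/(_ 0 i) := hermitian_spectral_diag_real Hh.
Qed.

Lemma expmx_conj n (P Q D : 'M[C]_n) k : P *m Q = 1%:M -> Q *m P = 1%:M ->
  (Q *m D *m P) ^+ k = Q *m D ^+ k *m P.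
Proof.
move=> PQ QP; elim: k => [|k IH]; first by rewrite !expr0 mulmx1 QP.
rewrite !exprS IH -!mulmxE !mulmxA; congr (_ *m _ *m _).
by rewrite -(mulmxA _ P Q) PQ mulmx1.
Qed.

Lemma diag_mxX n (v : 'rV[C]_n) k : diag_mx v ^+ k = diag_mx (\row_i v 0 i ^+ k).
Proof.
elim: k => [|k IH].
  by rewrite expr0; apply/matrixP => i j; rewrite !mxE expr0.
rewrite exprS IH -mulmxE mulmx_diag; congr diag_mx.
by apply/rowP => i; rewrite !mxE exprS.
Qed.

Lemma trace_diagonalized n (P : 'M[C]_n) (v : 'rV[C]_n) k :
  P *m adjoint P = 1%:M -> adjoint P *m P = 1%:M ->
  \tr ((adjoint P *m diag_mx v *m P) ^+ k) = \sum_i v 0 i ^+ k.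
Proof.
move=> PQ QP; rewrite expmx_conj // mxtrace_mulC mulmxA PQ mul1mx diag_mxX.
by rewrite mxtrace_diag; apply: eq_bigr => i _; rewrite mxE.
Qed.

Lemma cvgn_sum (I : Type) (r : seq I) (u : I -> R^nat) (l : I -> R) :
  (forall i, u i m @[m --> \oo] --> l i) ->
  (\sum_(i <- r) u i m) @[m --> \oo] --> \sum_(i <- r) l i.
Proof.
move=> ul; elim: r => [|i r IH].
  rewrite big_nil; under eq_fun do rewrite big_nil.
  exact: cvg_cst.
rewrite big_cons; under eq_fun do rewrite big_cons.
exact: cvgD (ul i) IH.
Qed.

(** The trace of a power is the sum of the powers of the eigenvalues, so each partial sum of the
    defining series is a finite sum of partial sums of scalar exponential series; the limit is taken
    term by term. *)
Lemma tr_exp_diagonalized n (P : 'M[C]_n) (lam : 'I_n -> R) (beta : R) :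
  P *m adjoint P = 1%:M -> adjoint P *m P = 1%:M ->
  tr_exp beta (adjoint P *m diag_mx (\row_i (lam i)%:C) *m P)
  = \sum_i expR (- beta * lam i).
Proof.
move=> PQ QP; rewrite /tr_exp.
have -> : (fun m : nat => complex.Re (\sum_(k < m)
   \tr ((adjoint P *m diag_mx (\row_i (lam i)%:C) *m P) ^+ k)
      * ((- beta) ^+ k / k`!%:R)%:C)) =
   (fun m => \sum_i series (exp_coeff (- beta * lam i)) m).
  apply/funext => m.
  rewrite Re_sum [RHS](eq_bigr (fun i => \sum_(k < m) exp_coeff (- beta * lam i) k)); last first.
    by move=> i _; rewrite /series /= big_mkord.
  rewrite exchange_big /=; apply: eq_bigr => k _.
  rewrite trace_diagonalized // mulr_suml Re_sum; apply: eq_bigr => i _.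
  rewrite mxE -rmorphXn mulrC Re_realM Re_real /exp_coeff /= exprMn.
  by rewrite mulrAC.
apply/cvg_lim => //; apply: cvgn_sum => i.
exact: is_cvg_series_exp_coeff.
Qed.

(** A diagonal entry is an average of the eigenvalues, so some eigenvalue does not exceed it; the
    exponential of that one is a single term of a nonnegative sum. *)
Lemma tr_exp_ge n (H : 'M[C]_n) (beta : R) (j : 'I_n) : adjoint H = H ->
  0 <= beta -> expR (- beta * complex.Re (H j j)) <= tr_exp beta H.
Proof.
move=> Hh b0; have [P [lam [PQ QP HE]]] := hermitian_diagonalization Hh.
rewrite [in leRHS]HE tr_exp_diagonalized //.
(* The distribution of the basis vector [j] over the eigenvectors; its mass is one because [P] is
   unitary. *)
pose q i := cabs (P i j) ^+ 2.
have qC i : adjoint P j i * P i j = (q i)%:C.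
  by rewrite mxE mulrC -sqr_normc cabsE rmorphXn.
have q1 : \sum_i q i = 1.
  apply: (@complexI R); rewrite rmorph_sum rmorph1 /=.
  under eq_bigr do rewrite -qC.
  by move/matrixP/(_ j j): QP; rewrite !mxE eqxx.
have HjE : complex.Re (H j j) = \sum_i lam i * q i.
  rewrite HE mul_mx_diag mxE Re_sum; apply: eq_bigr => i _.
  by rewrite mxE mulrAC qC mxE -rmorphM mulrC.
(* Otherwise the [q]-average of the positive differences [lam i - complex.Re (H j j)] would be zero,
   which forces every [q i] to vanish. *)
have [i lei] : exists i, lam i <= complex.Re (H j j).
  apply/not_existsP => hn.
  have hlt i : complex.Re (H j j) < lam i by rewrite ltNge; apply/negP.
  have : \sum_i (lam i - complex.Re (H j j)) * q i = 0.
    under eq_bigr do rewrite mulrBl.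
    by rewrite sumrB -mulr_sumr q1 mulr1 -HjE subrr.
  move=> /eqP; rewrite psumr_eq0; last first.
    by move=> i _; rewrite mulr_ge0 ?exprn_ge0 ?cabs_ge0 // subr_ge0 ltW.
  move=> /allP h; have : \sum_i q i = 0.
    apply: big1 => i _; have := h i (mem_index_enum i).
    by rewrite /= mulf_eq0 subr_eq0 gt_eqF //= => /eqP.
  by rewrite q1 => /eqP; rewrite oner_eq0.
rewrite (bigD1 i) //= -[leLHS]addr0; apply: lerD.
  by rewrite ler_expR !mulNr lerN2 ler_wpM2l.
by apply: sumr_ge0 => k _; exact: expR_ge0.
Qed.

(** Each of the [n] terms of the trace belongs to a row of [P], a nonzero eigenvector to which the
    hypothesis applies. *)
Lemma tr_exp_le n (H : 'M[C]_n) (beta E : R) : adjoint H = H ->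
  0 <= beta ->
  (forall (lam : R) (v : 'rV[C]_n), v != 0 -> v *m H = lam%:C *: v -> E <= lam) ->
  tr_exp beta H <= n%:R * expR (- beta * E).
Proof.
move=> Hh b0 HE; have [P [lam [PQ QP HD]]] := hermitian_diagonalization Hh.
rewrite HD tr_exp_diagonalized //.
rewrite -[n in n%:R]card_ord -sum1_card natr_sum mulr_suml.
apply: ler_sum => i _; rewrite mul1r ler_expR !mulNr lerN2 ler_wpM2l //.
have row0 : row i P != 0.
  apply/eqP => /rowP r0; move/matrixP/(_ i i): PQ; rewrite !mxE eqxx big1 //.
    by move/eqP; rewrite eq_sym oner_eq0.
  by move=> k _; have := r0 k; rewrite !mxE => ->; rewrite mul0r.
apply: HE row0 _; rewrite HD -row_mul !mulmxA PQ mul1mx row_mul row_diag_mx.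
by rewrite -scalemxAl -rowE mxE.
Qed.

End Spectral.

(** * Algebra of adjoints *)

Section Adjoints.
Variable R : realType.
Local Open Scope complex_scope.
Local Notation C := R[i].

Lemma adjointD (n : nat) (A T : 'M[C]_n) : adjoint (A + T) = adjoint A + adjoint T.
Proof. by apply/matrixP => i j; rewrite !mxE rmorphD. Qed.

Lemma adjointZ (n : nat) (a : R) (A : 'M[C]_n) :
  adjoint (a%:C *: A) = a%:C *: adjoint A.
Proof.
by apply/matrixP => i j; rewrite !mxE rmorphM; congr (_ * _); exact: conjc_real.
Qed.

Lemma adjointM (m : nat) (A B : 'M[C]_m) : adjoint (A *m B) = adjoint B *m adjoint A.
Proof.
apply/matrixP => i j; rewrite !mxE rmorph_sum; apply: eq_bigr => k _.
by rewrite !mxE mulrC rmorphM.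
Qed.

Lemma adjointK (m : nat) (A : 'M[C]_m) : adjoint (adjoint A) = A.
Proof. by apply/matrixP => i j; rewrite !mxE conjcK. Qed.

Lemma adjoint_sum (n : nat) I (r : seq I) (P : pred I) (F : I -> 'M[C]_n) :
  adjoint (\sum_(i <- r | P i) F i) = \sum_(i <- r | P i) adjoint (F i).
Proof.
apply: (big_morph _ (@adjointD n)).
by apply/matrixP => i j; rewrite !mxE conjc0.
Qed.

End Adjoints.

(** * Operators by their entries, and a weighted Gershgorin bound *)

Section OperatorEntries.
Variables (R : realType) (B : finType).
Local Open Scope complex_scope.
Local Notation C := R[i].
Implicit Types (A T : opB R B) (x y : B) (g : B -> R).

Lemma entry_op_of (f : B -> B -> C) x y : entry (op_of f) x y = f x y.
Proof. by rewrite /entry mxE !enum_rankK. Qed.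

Lemma entry_inj A T : (forall x y, entry A x y = entry T x y) -> A = T.
Proof.
move=> AT; apply/matrixP => i j; have := AT (enum_val i) (enum_val j).
by rewrite /entry !enum_valK.
Qed.

Lemma entryD A T x y : entry (A + T) x y = entry A x y + entry T x y.
Proof. by rewrite /entry mxE. Qed.

Lemma entryN A x y : entry (- A) x y = - entry A x y.
Proof. by rewrite /entry mxE. Qed.

Lemma entryZ (a : C) A x y : entry (a *: A) x y = a * entry A x y.
Proof. by rewrite /entry mxE. Qed.

Lemma entry_sum I (r : seq I) (P : pred I) (F : I -> opB R B) x y :
  entry (\sum_(i <- r | P i) F i) x y = \sum_(i <- r | P i) entry (F i) x y.
Proof. by rewrite /entry summxE. Qed.

Lemma entry_scalar (a : C) x y :
  entry (a%:M : opB R B) x y = if x == y then a else 0.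
Proof. by rewrite /entry mxE (inj_eq enum_rank_inj); case: eqP. Qed.

Lemma sum_enum_rank (V : nmodType) (F : 'I_#|B| -> V) :
  \sum_i F i = \sum_(x : B) F (enum_rank x).
Proof.
rewrite (reindex_onto enum_rank enum_val) /=; last by move=> i _; rewrite enum_valK.
by apply: eq_bigl => x; rewrite enum_rankK eqxx.
Qed.

Lemma entryM A T x y : entry (A *m T) x y = \sum_z entry A x z * entry T z y.
Proof. by rewrite /entry mxE sum_enum_rank. Qed.

Lemma entry_adjoint A x y : entry (adjoint A) x y = conjc (entry A y x).
Proof. by rewrite /entry mxE. Qed.

Lemma adjoint_entry A :
  (forall x y, conjc (entry A y x) = entry A x y) -> adjoint A = A.
Proof. by move=> h; apply: entry_inj => x y; rewrite entry_adjoint. Qed.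

Definition diagop g : opB R B := op_of (fun x y => if x == y then (g x)%:C else 0).

Lemma entry_diagop g x y : entry (diagop g) x y = if x == y then (g x)%:C else 0.
Proof. exact: entry_op_of. Qed.

Lemma diagopM g1 g2 : diagop g1 *m diagop g2 = diagop (fun x => g1 x * g2 x).
Proof.
apply: entry_inj => x y; rewrite entryM (bigD1 x) //= big1 ?addr0; last first.
  by move=> z zx; rewrite entry_diagop eq_sym (negPf zx) mul0r.
by rewrite !entry_diagop eqxx; case: eqP => _; rewrite ?mulr0 // rmorphM.
Qed.

Lemma diagopB g1 g2 : diagop g1 - diagop g2 = diagop (fun x => g1 x - g2 x).
Proof.
apply: entry_inj => x y; rewrite entryD entryN !entry_diagop.
by case: eqP => _; rewrite ?subr0 // rmorphB.
Qed.

Lemma diagopZ (a : R) g : a%:C *: diagop g = diagop (fun x => a * g x).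
Proof.
apply: entry_inj => x y; rewrite entryZ !entry_diagop.
by case: eqP => _; rewrite ?mulr0 // rmorphM.
Qed.

Lemma diagop_sum (I : finType) (g : I -> B -> R) :
  \sum_i diagop (g i) = diagop (fun x => \sum_i g i x).
Proof.
apply: entry_inj => x y; rewrite entry_sum entry_diagop.
under eq_bigr do rewrite entry_diagop.
by case: eqP => _; [rewrite rmorph_sum | rewrite big1].
Qed.

Lemma adjoint_diagop g : adjoint (diagop g) = diagop g.
Proof.
apply: adjoint_entry => x y; rewrite !entry_diagop eq_sym.
by case: eqP => [->|_]; [exact: conjc_real | exact: conjc0].
Qed.

(* Evaluate the eigenvector equation where [|v| / w] is maximal. *)
Lemma weighted_gershgorin g T (w : B -> R) (E lam : R) (v : 'rV[C]_#|B|) :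
  (forall x, 0 < w x) ->
  (forall x, \sum_y cabs (entry T y x) * w y <= (g x - E) * w x) ->
  v != 0 -> v *m (diagop g + T) = lam%:C *: v -> E <= lam.
Proof.
move=> w0 hE v0 vlam; have [i vi] : exists i, v 0 i != 0.
  by apply/rV0Pn.
pose u x := v 0 (enum_rank x); pose f x := cabs (u x) / w x.
have [x _ xmax'] := @Order.TotalTheory.arg_maxP _ _ B (enum_val i) xpredT f isT.
have xmax y : f y <= f x by exact: xmax'.
have vf y : cabs (u y) = f y * w y by rewrite divfK // gt_eqF.
have ux0 : 0 < cabs (u x).
  have : 0 < f (enum_val i).
    rewrite divr_gt0 // /u enum_valK lt_neqAle cabs_ge0 andbT eq_sym.
    by apply: contra vi => /eqP e0; rewrite -normr_eq0 cabsE e0.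
  by move=> h; rewrite vf mulr_gt0 // (lt_le_trans h) // xmax.
have eqx : (lam - g x)%:C * u x = \sum_y u y * entry T y x.
  move/rowP/(_ (enum_rank x)): vlam; rewrite mulmxDr !mxE !sum_enum_rank -/(u x).
  rewrite (bigD1 x) //= [X in _ + X + _]big1 ?addr0; last first.
    by move=> y yx; rewrite -/(entry _ y x) entry_diagop (negPf yx) mulr0.
  rewrite -/(entry _ x x) entry_diagop eqxx -/(u x) => e.
  by rewrite rmorphB mulrBl -e [u x * _]mulrC addrAC subrr add0r.
have : `|lam - g x| * cabs (u x) <= (g x - E) * cabs (u x).
  rewrite -cabs_real -cabsM eqx (le_trans (cabs_sum _ _ _)) //.
  rewrite vf mulrCA; apply: le_trans (_ : f x * (\sum_y cabs (entry T y x) * w y) <= _).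
    rewrite mulr_sumr; apply: ler_sum => y _.
    rewrite cabsM vf mulrAC -mulrA [cabs _ * _]mulrC ler_wpM2r ?xmax //.
    by rewrite mulr_ge0 ?cabs_ge0 // ltW.
  by rewrite ler_wpM2l // divr_ge0 ?cabs_ge0 // ltW.
by rewrite ler_pM2r // ler_norml => /andP[+ _]; lra.
Qed.

End OperatorEntries.

(** * From bounds on the lowest energy to a bound on the pressure *)

Section Pressure.
Variable R : realType.
Local Open Scope complex_scope.

(** The entry at [j] bounds the lowest energy from above and the eigenvalue hypothesis bounds it
    from below, both within [delta] per site of [- m]. The term [3 / beta] accounts for the
    dimension factor in [tr_exp_le]. *)
Lemma pressure_estimate (B : finType) (H : opB R B) (j : B) (N : nat)
    (beta m delta : R) :
  (0 < N)%N -> 0 < beta -> (#|B| <= 4 ^ N)%N -> adjoint H = H ->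
  complex.Re (entry H j j) <= - (m - delta) * N%:R ->
  (forall (lam : R) (v : 'rV[R[i]]_#|B|), v != 0 -> v *m H = lam%:C *: v ->
     - (m + delta) * N%:R <= lam) ->
  `| (beta * N%:R)^-1 * ln (tr_exp beta H) - m | <= delta + 3 / beta.
Proof.
move=> N0 b0 cB Hh Hj Hlam.
have N0' : 0 < N%:R :> R by rewrite ltr0n.
have bN0 : 0 < beta * N%:R by rewrite mulr_gt0.
have lo := tr_exp_ge (enum_rank j) Hh (ltW b0).
have up := tr_exp_le Hh (ltW b0) Hlam.
have tr0 : 0 < tr_exp beta H by apply: lt_le_trans lo; exact: expR_gt0.
have lo' : beta * N%:R * (m - delta) <= ln (tr_exp beta H).
  rewrite -ler_expR lnK ?posrE //; apply: le_trans lo; rewrite ler_expR.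
  rewrite mulNr lerNr -mulrN -!mulrA ler_pM2l // mulrN mulrC -mulNr.
  exact: Hj.
have up' : ln (tr_exp beta H) <= 3 * N%:R + beta * N%:R * (m + delta).
  rewrite -ler_expR lnK ?posrE //; apply: le_trans up _.
  rewrite expRD; apply: ler_pM => //; rewrite ?expR_ge0 ?ler0n //; last first.
    by rewrite ler_expR; lra.
  apply: le_trans (_ : 4 ^+ N <= _); first by rewrite -natrX ler_nat.
  rewrite mulrC -mulr_natl expRM_natl lerXn2r ?nnegrE ?expR_ge0 //.
  (* The constant 3 originates here: [4 = 1 + 3 <= expR 3]. *)
  by apply: le_trans (expR_ge1Dx 3); lra.
rewrite ler_norml; apply/andP; split.
- rewrite lerBrDr [_^-1 * ln _]mulrC ler_pdivlMr //.
  apply: le_trans lo'; rewrite mulrC ler_pM2l //.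
  have : 0 <= 3 / beta by rewrite divr_ge0 // ltW.
  lra.
rewrite lerBlDr [_^-1 * ln _]mulrC ler_pdivrMr //; apply: le_trans up' _.
have -> : (delta + 3 / beta + m) * (beta * N%:R)
   = 3 * N%:R + beta * N%:R * (m + delta) by field; rewrite gt_eqF.
by [].
Qed.

End Pressure.

(** * Bonds and neighbours on the torus *)

Section Lattice.
Variables (L d : nat).
Local Notation X := (site L d).
Local Notation adjacent := (@Defs.adjacent L d).
Implicit Types x y : X.

Lemma adjacent_sym x y : adjacent x y = adjacent y x.
Proof. by apply: eq_existsb => i; rewrite orbC. Qed.

Lemma adjacent_irr x : ~~ adjacent x x.
Proof.
apply/existsP => [[j]]; rewrite orbb => /eqP/ffunP/(_ j).
rewrite ffunE eqxx => /eqP; rewrite eq_sym -subr_eq0 addrC addKr.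
by rewrite oner_eq0.
Qed.

(** The enumeration order selects one of the two orderings of a bond. Since bonds are sets, two
    sites joined by both shifts when [L = 2] still form one bond. *)
Lemma bond_sumE (V : zmodType) (F : X -> X -> V) :
  bond_sum F =
  \sum_x \sum_(y | (enum_rank x < enum_rank y)%N && adjacent x y) F x y.
Proof.
rewrite /bond_sum.
under eq_bigr do rewrite big_mkcond /=.
rewrite exchange_big /=; apply: eq_bigr => x _.
under eq_bigr => b _.
  rewrite (_ : (if x \in b then _ else _) =
    \sum_(y | (x \in b) && ((y \in b) && (enum_rank x < enum_rank y)%N)) F x y); last first.
    by case: ifP => _ //=; rewrite big_pred0_eq.
  rewrite big_mkcond /=; over.
rewrite exchange_big /= [RHS]big_mkcond; apply: eq_bigr => y _ /=.
(* If [x] precedes [y] and they are adjacent, the only bond containing both is the set they form;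
   otherwise no bond contributes. *)
rewrite -big_mkcondr /=; case: ifP => [/andP[xy axy]|h].
  rewrite (big_pred1 [set x; y]%SET) // => b /=; apply/idP/eqP.
    move=> /andP[]; rewrite inE => /existsP[u /existsP[v /andP[_ /eqP->]]].
    rewrite !inE xy andbT => /andP[xuv yuv].
    have nxy : x != y by apply: contraTneq xy => ->; rewrite ltnn.
    apply/setP => z; rewrite !inE.
    by move: xuv yuv nxy => /orP[]/eqP-> /orP[]/eqP->; rewrite ?eqxx // orbC.
  move=> ->; rewrite !inE !eqxx orbT xy andbT /= andbT.
  by apply/existsP; exists x; apply/existsP; exists y; rewrite axy eqxx.
apply: big1_seq => b /andP[/andP[bb /and3P[xb yb xy]] _]; move: h; rewrite xy /=.
move: bb xb yb xy; rewrite inE => /existsP[u /existsP[v /andP[auv /eqP->]]].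
rewrite !inE => /orP[]/eqP-> /orP[]/eqP->; rewrite ?ltnn //.
  by rewrite auv.
by rewrite adjacent_sym auv.
Qed.

(** Swapping the summation variables turns the [F y x] half into the pairs in decreasing order;
    there are no diagonal pairs, by [adjacent_irr]. *)
Lemma bond_sum_pairs (V : zmodType) (F : X -> X -> V) :
  bond_sum (fun x y => F x y + F y x) = \sum_x \sum_(y | adjacent x y) F x y.
Proof.
rewrite bond_sumE.
under eq_bigr do rewrite big_split /=.
rewrite big_split /= addrC.
under eq_bigr do rewrite big_mkcond /=.
rewrite exchange_big /= addrC -big_split /=; apply: eq_bigr => x _.
rewrite -big_mkcond /= [RHS](bigID (fun y => (enum_rank x < enum_rank y)%N)) /=.
congr (_ + _); apply: eq_bigl => y; first by rewrite andbC.
have [->|nxy] := eqVneq x y; first by rewrite (negPf (adjacent_irr y)) andbF.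
rewrite adjacent_sym -leqNgt ltn_neqAle (inj_eq val_inj) (inj_eq enum_rank_inj).
by rewrite eq_sym nxy andbC.
Qed.

(** The neighbours are images of [x] under the signed unit shifts, two of which coincide when
    [L = 2]. *)
Lemma card_adjacent x : (#|[pred y | adjacent x y]| <= 2 * d)%N.
Proof.
pose f (p : 'I_d * bool) : X :=
  [ffun j => if j == p.1 then (if p.2 then x j + 1 else x j - 1)%R else x j].
have -> : (2 * d)%N = #|{: 'I_d * bool}| by rewrite card_prod card_ord card_bool mulnC.
apply: leq_trans (leq_image_card f _); apply/subset_leq_card/fintype.subsetP => y.
rewrite inE => /existsP[i /orP[]/eqP e]; apply/fintype.imageP.
  by exists (i, true) => //; apply/ffunP => j; rewrite e !ffunE /=.
exists (i, false) => //; apply/ffunP => j; rewrite !ffunE /= e !ffunE.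
by case: eqP => //= _; rewrite addrK.
Qed.

Lemma card_site_gt0 : (0 < #|X|)%N.
Proof. by apply/card_gt0P; exists [ffun=> 0]. Qed.

End Lattice.

(** * Weighted column sums *)

Section ColumnSums.
Variables (R : realType) (B : finType).
Local Open Scope complex_scope.
Local Notation C := R[i].
Implicit Types (A T : opB R B) (w : B -> R) (x y : B).

(** The quantity bounded in the hypothesis of [weighted_gershgorin]. For unit weights its maximum
    over [x] is the operator norm on l^1. *)
Definition colsum w T x : R := \sum_y cabs (entry T y x) * w y.

Lemma colsumD w A T x : (forall y, 0 <= w y) ->
  colsum w (A + T) x <= colsum w A x + colsum w T x.
Proof.
move=> w0; rewrite -big_split /=; apply: ler_sum => y _.
by rewrite -mulrDl ler_wpM2r // entryD cabsD.
Qed.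

Lemma colsumN w T x : colsum w (- T) x = colsum w T x.
Proof. by apply: eq_bigr => y _; rewrite entryN cabsN. Qed.

Lemma colsumZ w (a : R) T x : colsum w (a%:C *: T) x = `|a| * colsum w T x.
Proof.
rewrite /colsum mulr_sumr; apply: eq_bigr => y _.
by rewrite entryZ cabsM cabs_real mulrA.
Qed.

Lemma colsum_sum w I (r : seq I) (P : pred I) (F : I -> opB R B) x :
  (forall y, 0 <= w y) ->
  colsum w (\sum_(i <- r | P i) F i) x <= \sum_(i <- r | P i) colsum w (F i) x.
Proof.
move=> w0; elim/big_ind2: _ => [|A a T b Aa Tb|//].
  by rewrite /colsum big1 // => y _; rewrite /entry mxE cabs0 mul0r.
exact: le_trans (colsumD _ _ _ w0) (lerD Aa Tb).
Qed.

Lemma colsum_scalar w (a : R) x : colsum w (a%:C%:M : opB R B) x = `|a| * w x.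
Proof.
rewrite /colsum (bigD1 x) //= big1 ?addr0; last first.
  by move=> y /negPf yx; rewrite entry_scalar yx cabs0 mul0r.
by rewrite entry_scalar eqxx cabs_real.
Qed.

(** Submultiplicativity of the l^1 operator norm. *)
Lemma colsum1M A T a b : (forall x, colsum (fun=> 1) A x <= a) ->
  (forall x, colsum (fun=> 1) T x <= b) ->
  forall x, colsum (fun=> 1) (A *m T) x <= a * b.
Proof.
move=> hA hT x; have [y _|B0] := pickP (fun y : B => true); last first.
  by have := B0 x.
have a0 : 0 <= a.
  by apply: le_trans (hA y); apply: sumr_ge0 => z _; rewrite mulr1 cabs_ge0.
apply: le_trans (_ : a * colsum (fun=> 1) T x <= _); last by rewrite ler_wpM2l.
apply: le_trans (_ : \sum_y \sum_z cabs (entry A y z) * cabs (entry T z x) <= _).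
  apply: ler_sum => z _; rewrite mulr1 entryM (le_trans (cabs_sum _ _ _)) //.
  by apply: ler_sum => u _; rewrite cabsM.
rewrite exchange_big /= mulr_sumr; apply: ler_sum => z _.
rewrite -mulr_suml mulr1 ler_wpM2r ?cabs_ge0 //.
by apply: le_trans (hA z); apply: ler_sum => u _; rewrite mulr1.
Qed.

Lemma cabs_diag_le_colsum1 T x : cabs (entry T x x) <= colsum (fun=> 1) T x.
Proof.
rewrite /colsum (bigD1 x) //= mulr1 lerDl.
by apply: sumr_ge0 => y _; rewrite mulr1 cabs_ge0.
Qed.

End ColumnSums.

(** * Staggered field and Neel configurations *)

Section Staggered.
Variables (R : realType) (L d : nat).
Local Notation X := (site L d).

(** Spin [up] where [eta] is 1 and the opposite spin elsewhere: the two values of [up] give the two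
    Neel states. *)
Definition neel (up : bool) (x : X) : bool := odd (\sum_(i < d) x i) (+) up.

Lemma eta_neel up (x : X) :
  Defs.eta R x * (if neel up x then 1 else -1) = if up then 1 else -1.
Proof.
rewrite /Defs.eta -signr_odd /neel; case: (odd _); case: up => /=;
  by rewrite ?expr0 ?expr1 ?mulr1 ?mulrN1 ?mul1r ?opprK.
Qed.

Lemma norm_eta (x : X) : `|Defs.eta R x| = 1.
Proof. by rewrite /Defs.eta normrX normrN1 expr1n. Qed.

Lemma norm_staggered_sum (f : X -> R) : (forall x, `|f x| <= 1 / 2) ->
  `|\sum_x Defs.eta R x * f x| <= #|X|%:R / 2.
Proof.
move=> hf; apply: le_trans (ler_norm_sum _ _ _) _.
rewrite -sum1_card natr_sum mulr_suml; apply: ler_sum => x _.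
by rewrite normrM norm_eta mul1r.
Qed.

(** As the orientation follows the sign of [h], every site contributes |h|/2, so the bound of
    [norm_staggered_sum] is attained. *)
Lemma field_energy_neel (h : R) (f : X -> R) :
  (forall x, f x = 1 / 2 * (if neel (0 <= h) x then 1 else -1)) ->
  h * (\sum_x Defs.eta R x * f x) = `|h| / 2 * #|X|%:R.
Proof.
move=> hf; under eq_bigr do rewrite hf mulrCA eta_neel.
rewrite sumr_const -[_ *+ #|_|]mulr_natr mulrA; congr (_ * _).
by case: ger0P => _; lra.
Qed.

End Staggered.

(** * Spin operators in the configuration basis *)

Section Heisenberg.
Variables (R : realType) (L d : nat).
Local Open Scope complex_scope.
Local Notation C := R[i].
Local Notation X := (site L d).
Local Notation S := (sconfig L d).
Implicit Types (x y : X) (s : S) (a : 'I_3).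

Definition upd s x (b : bool) : S := [ffun z => if z == x then b else s z].

(** A configuration agreeing with [s] off [x] is determined by its value at [x]; this reduces sums
    against a single-site operator to two terms. *)
Lemma big_agree (V : nmodType) (F : S -> V) s x :
  \sum_(s' : S | [forall z, (z != x) ==> (s' z == s z)]) F s' =
  \sum_(b : bool) F (upd s x b).
Proof.
rewrite (partition_big (fun s' : S => s' x) predT) //=.
apply: eq_bigr => b _; apply: big_pred1 => s' /=; apply/andP/eqP.
  move=> [/forallP h /eqP <-]; apply/ffunP => z; rewrite ffunE.
  by have [->//|zx] := eqVneq; have := h z; rewrite zx => /eqP.
move=> ->; split; last by rewrite ffunE eqxx.
by apply/forallP => z; apply/implyP => zx; rewrite ffunE (negPf zx).
Qed.

Lemma pauli_conj a (b c : bool) : conjc (pauli R a b c) = pauli R a c b.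
Proof.
rewrite /pauli; case: a => [[|[|[|m]]] hm] /=; case: b; case: c => //=;
  by rewrite ?conjc1 ?conjc0 //; apply/eqP; rewrite eq_complex /= ?oppr0 ?opprK !eqxx.
Qed.

(** Each column of a Pauli matrix has a single nonzero entry, of modulus one. *)
Lemma pauli_colsum a (c : bool) : \sum_(b : bool) cabs (pauli R a b c) = 1.
Proof.
have ci : cabs ('i%C : R[i]) = 1.
  by rewrite /cabs normc_def /= expr0n add0r expr1n sqrtr1.
rewrite big_bool /pauli; case: a => [[|[|[|m]]] hm] //=; case: c => //=;
  by rewrite ?cabsN ?ci ?cabs0 ?cabs1 ?addr0 ?add0r.
Qed.

Lemma colsum_Sop a x s : colsum (fun=> 1) (Sop R a x) s = 1 / 2.
Proof.
rewrite /colsum; under eq_bigr do rewrite mulr1 /Sop entry_op_of.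
rewrite (eq_bigr (fun s' : S => if [forall z, (z != x) ==> (s' z == s z)]
   then cabs ((1 / 2 : R)%:C * pauli R a (s' x) (s x)) else 0)); last first.
  by move=> s' _; case: ifP => // _; rewrite cabs0.
rewrite -big_mkcond big_agree.
under eq_bigr do rewrite ffunE eqxx cabsM.
by rewrite -mulr_sumr pauli_colsum mulr1 cabs_real ger0_norm //; lra.
Qed.

(** The intermediate configuration is forced: it agrees with [s'] off [x] and, because [x != y],
    with [s] at [x]. In this form Hermiticity of [SdotS] can be read off entry by entry. *)
Lemma entry_SopSop a x y s' s : x != y ->
  entry (Sop R a x *m Sop R a y) s' s =
  if [forall z, (z != x) && (z != y) ==> (s' z == s z)]
  then (1 / 4 : R)%:C * (pauli R a (s' x) (s x) * pauli R a (s' y) (s y)) else 0.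
Proof.
move=> xy; rewrite entryM.
rewrite (eq_bigr (fun m : S => if [forall z, (z != x) ==> (m z == s' z)]
   then (1 / 2 : R)%:C * pauli R a (s' x) (m x) * entry (Sop R a y) m s else 0));
  last first.
  move=> m _; rewrite {1}/Sop entry_op_of.
  rewrite [in RHS](eq_forallb (P2 := fun z => (z != x) ==> (s' z == m z))).
    by case: ifP => _ //; rewrite mul0r.
  by move=> z; rewrite [m z == _]eq_sym.
rewrite -big_mkcond big_agree (bigD1 (s x)) //= big1 ?addr0; last first.
  move=> b bs; rewrite /Sop entry_op_of; case: ifP => [/forallP/(_ x)|]; last by rewrite mulr0.
  by rewrite xy /= ffunE eqxx (negPf bs).
rewrite {1}/upd ffunE eqxx /Sop entry_op_of !ffunE eq_sym (negPf xy).
rewrite (_ : [forall z, _] = [forall z, (z != x) && (z != y) ==> (s' z == s z)]).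
  case: ifP => _; rewrite ?mulr0 // mulrACA -rmorphM; congr (_%:C * _); lra.
apply: eq_forallb => z; rewrite ffunE.
by have [->|zx] := eqVneq z x; rewrite ?eqxx ?xy.
Qed.

Lemma adjoint_SdotS x y : x != y -> adjoint (SdotS R x y) = SdotS R x y.
Proof.
move=> xy; apply: adjoint_entry => s' s.
rewrite !entry_sum rmorph_sum; apply: eq_bigr => a _.
rewrite !entry_SopSop //=.
rewrite (eq_forallb (P2 := fun z => (z != x) && (z != y) ==> (s' z == s z))); last first.
  by move=> z; rewrite [s z == _]eq_sym.
case: ifP => _; last exact: conjc0.
rewrite [LHS]rmorphM [X in _ * X]rmorphM.
by congr (_ * (_ * _)); [exact: conjc_real | exact: pauli_conj..].
Qed.

(** Each of the three spin components contributes at most 1/4, and so does the scalar. *)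
Lemma colsum_SdotS x y s :
  colsum (fun=> 1) (SdotS R x y - (1 / 4 : R)%:C%:M) s <= 1.
Proof.
apply: le_trans (colsumD _ _ _ (fun=> ler01)) _; rewrite colsumN colsum_scalar.
apply: le_trans (_ : 3 / 4 + 1 / 4 <= _); last by lra.
apply: lerD; last by rewrite ger0_norm; lra.
apply: le_trans (colsum_sum _ _ _ _ (fun=> ler01)) _.
apply: le_trans (_ : \sum_(a < 3) (1 / 2 * (1 / 2)) <= _).
  by apply: ler_sum => a _; apply: colsum1M => z; rewrite colsum_Sop.
rewrite sumr_const card_ord; lra.
Qed.

Definition spinM s : R := \sum_x Defs.eta R x * (1 / 2 * (if s x then 1 else -1)).

Lemma Sop2E x : Sop R 2 x = diagop (fun s => 1 / 2 * (if s x then 1 else -1)).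
Proof.
apply: entry_inj => s' s; rewrite entry_diagop entry_op_of.
have [->|ne] := eqVneq s' s.
  rewrite ifT; last by apply/forallP => z; rewrite eqxx implybT.
  by rewrite /pauli /= eqxx; case: (s x); rewrite [in RHS]rmorphM ?rmorphN rmorph1.
case: ifP => // /forallP h; rewrite /pauli /=; case: eqP => [e|_]; last by rewrite mulr0.
case/negP: ne; apply/eqP/ffunP => z; have [->//|zx] := eqVneq z x.
by have := h z; rewrite zx => /eqP.
Qed.

Lemma etaC x : Defs.eta C x = (Defs.eta R x)%:C.
Proof. by rewrite /Defs.eta rmorphXn rmorphN rmorph1. Qed.

Lemma MspinE : Mspin R L d = diagop spinM.
Proof.
rewrite -diagop_sum; apply: eq_bigr => x _.
by rewrite etaC Sop2E diagopZ.
Qed.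

End Heisenberg.

(** * Sums over ordered pairs of neighbours *)

Section AdjacentSums.
Variables (R : realType) (L d : nat).
Local Notation X := (site L d).

Lemma sum_adjacent_l (G : X -> R) : (forall x, 0 <= G x) ->
  \sum_x \sum_(y | Defs.adjacent x y) G x <= 2 * d%:R * \sum_x G x.
Proof.
move=> G0; rewrite mulr_sumr; apply: ler_sum => x _.
rewrite sumr_const -[_ *+ #|_|]mulr_natl ler_wpM2r // -natrM ler_nat.
exact: card_adjacent.
Qed.

Lemma sum_adjacent_r (G : X -> R) : (forall x, 0 <= G x) ->
  \sum_x \sum_(y | Defs.adjacent x y) G y <= 2 * d%:R * \sum_x G x.
Proof.
move=> G0; under eq_bigr do rewrite big_mkcond.
rewrite exchange_big /=; under eq_bigr do rewrite -big_mkcond.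
under eq_bigr do under eq_bigl do rewrite adjacent_sym.
exact: sum_adjacent_l.
Qed.

End AdjacentSums.

(** * The Heisenberg pressure *)

Section HeisenbergPressure.
Variables (R : realType) (L d : nat).
Local Open Scope complex_scope.
Local Notation C := R[i].
Local Notation X := (site L d).
Local Notation S := (sconfig L d).

Definition heis_bonds : opB R S :=
  bond_sum (fun x y : X => SdotS R x y - (1 / 4 : R)%:C%:M).

Lemma H_HeisE (J h : R) :
  H_Heis L d J h = diagop (fun s => - h * spinM R s) + J%:C *: heis_bonds.
Proof.
rewrite /H_Heis MspinE addrC; congr (_ + _).
by rewrite -scaleNr -rmorphN diagopZ.
Qed.

Lemma adjoint_heis_bonds : adjoint heis_bonds = heis_bonds.
Proof.
rewrite /heis_bonds bond_sumE adjoint_sum; apply: eq_bigr => x _.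
rewrite adjoint_sum; apply: eq_bigr => y /andP[xy _].
rewrite adjointD adjoint_SdotS; last by apply: contraTneq xy => ->; rewrite ltnn.
congr (_ + _); apply: adjoint_entry => s s'.
by rewrite !entryN !entry_scalar eq_sym; case: eqP => _;
  rewrite rmorphN; congr (- _); [exact: conjc_real | exact: conjc0].
Qed.

Lemma colsum_heis_bonds s :
  colsum (fun=> 1) heis_bonds s <= 2 * d%:R * #|X|%:R.
Proof.
rewrite /heis_bonds bond_sumE.
apply: le_trans (colsum_sum _ _ _ _ (fun=> ler01)) _.
have -> : #|X|%:R = \sum_(x : X) (1 : R) by rewrite sumr_const.
apply: le_trans (sum_adjacent_l (fun=> ler01)).
apply: ler_sum => x _; apply: le_trans (colsum_sum _ _ _ _ (fun=> ler01)) _.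
rewrite big_mkcond [leRHS]big_mkcond /=; apply: ler_sum => y _.
case: (Defs.adjacent x y); rewrite ?andbF ?andbT //.
by case: ifP => _; rewrite ?ler01 ?colsum_SdotS.
Qed.

Lemma norm_spinM (s : S) : `|spinM R s| <= #|X|%:R / 2.
Proof.
apply: norm_staggered_sum => x.
by case: (s x); rewrite ?mulr1 ?mulrN1 ?normrN ger0_norm //; lra.
Qed.

(** The field term is diagonal, bounded by |h|/2 per site, and attains this bound at a Neel
    configuration. The exchange term has column sums at most [2 * d * J] per site, which serves as
    [delta] on both sides. *)
Lemma p_Heis_estimate (J h beta : R) : 0 < beta -> 0 <= J ->
  `| (beta * #|X|%:R)^-1 * ln (tr_exp beta (H_Heis L d J h)) - `|h| / 2 |
  <= 2 * d%:R * J + 3 / beta.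
Proof.
move=> b0 J0.
have hM (s : S) : `|h * spinM R s| <= `|h| / 2 * #|X|%:R.
  rewrite normrM mulrAC -mulrA ler_wpM2l //; exact: norm_spinM.
apply: (@pressure_estimate _ _ _ [ffun x => neel (0 <= h) x]).
- exact: card_site_gt0.
- by [].
- by rewrite card_ffun card_bool leq_exp2r ?card_site_gt0.
- by rewrite H_HeisE adjointD adjointZ adjoint_diagop adjoint_heis_bonds.
- rewrite H_HeisE entryD entryZ ReD Re_realM entry_diagop eqxx Re_real.
  rewrite mulNr (@field_energy_neel _ _ _ h); last by move=> x; rewrite ffunE.
  have : complex.Re (entry heis_bonds [ffun x => neel (0 <= h) x]
     [ffun x => neel (0 <= h) x]) <= 2 * d%:R * #|X|%:R.
    apply: le_trans (colsum_heis_bonds _).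
    apply: le_trans (cabs_diag_le_colsum1 _ _).
    by have := Re_ge_cabs (- entry heis_bonds [ffun x => neel (0 <= h) x]
     [ffun x => neel (0 <= h) x]); rewrite cabsN ReN; lra.
  move=> /(ler_wpM2l J0); lra.
move=> lam v v0; rewrite H_HeisE => vlam.
apply: (weighted_gershgorin (w := fun=> 1) _ _ v0 vlam) => // s.
rewrite mulr1; have := colsumZ (fun=> 1) J heis_bonds s.
rewrite /colsum => ->; rewrite (ger0_norm J0).
have := ler_wpM2l J0 (colsum_heis_bonds s); rewrite /colsum.
have := hM s; rewrite ler_norml => /andP[_].
lra.
Qed.

End HeisenbergPressure.

(** * Doublons, holes and hops of fermion configurations *)

Section FermionConfigurations.
Variables (L d : nat).
Local Notation X := (site L d).
Local Notation F := (fconfig L d).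
Implicit Types (n : F) (p q : mode L d) (x y : X) (s : bool).

Definition clear p n : F := [ffun q => if q == p then false else n q].
Definition move p q n : F :=
  [ffun r => if r == p then true else if r == q then false else n r].

Definition doublon n x := n (x, true) && n (x, false).
Definition hole n x := ~~ n (x, true) && ~~ n (x, false).
Definition doublons n := (\sum_x doublon n x)%N.

Lemma clear_inj p n n' : n p -> n' p -> (clear p n == clear p n') = (n == n').
Proof.
move=> np n'p; apply/eqP/eqP => [e|->//]; apply/ffunP => q.
by have := congr1 (fun f : F => f q) e; rewrite !ffunE; case: eqP => [->|//]; rewrite np n'p.
Qed.

(** Nonzero entries of [cre p *m ann q] require these cleared configurations to coincide, so such a
    hop has at most one nonzero entry per column. *)
Lemma clear_eq_move p q n n' : p != q -> n p -> clear p n = clear q n' ->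
  ~~ n' p /\ n = move p q n'.
Proof.
move=> pq np e; have er r := congr1 (fun f : F => f r) e; split.
  by have := er p; rewrite !ffunE eqxx (negPf pq) => <-.
apply/ffunP => r; have := er r; rewrite !ffunE.
by have [->|rp] := eqVneq r p; rewrite ?np.
Qed.

(** Only [x] and [y] change: [y] ceases to be a doublon if it was one, and [x] becomes one unless it
    was a hole. The additive form avoids truncated subtraction. *)
Lemma doublons_move x y s n : x != y -> n (y, s) -> ~~ n (x, s) ->
  (doublons (move (x, s) (y, s) n) + doublon n y + hole n x = doublons n + 1)%N.
Proof.
move=> xy ny nx; have yx : y != x by rewrite eq_sym.
pose m := move (x, s) (y, s) n.
have mE z r : m (z, r) = if (z == x) && (r == s) then true
    else if (z == y) && (r == s) then false else n (z, r).
  by rewrite ffunE !xpair_eqE.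
have key k : doublons k =
    (doublon k x + (doublon k y + \sum_(z | (z != x) && (z != y)) doublon k z))%N.
  by rewrite /doublons (bigD1 x) //= (bigD1 y).
rewrite -/m !{}key (eq_bigr (fun z => doublon n z : nat)); last first.
  by move=> z /andP[/negPf zx /negPf zy]; rewrite /doublon !mE zx zy.
rewrite /doublon /hole !mE !eqxx (negPf yx) (negPf xy) /=.
clear m mE; case: s ny nx => /= -> /negPf->;
  move: (\sum_(z | _) _)%N => D; case: (n _); case: (n _) => /=;
  rewrite ?addn0 ?add0n; lia.
Qed.

(** At each site, occupation plus hole equals one plus doublon; sum over the sites and cancel the
    particle number against [#|X|]. *)
Lemma half_filled_holes n : half_filled n -> (\sum_x hole n x)%N = doublons n.
Proof.
move=> /eqP hf; apply/eqP; rewrite -(eqn_add2l #|X|); apply/eqP.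
have cardE : #|[set p : mode L d | n p]%SET| = (\sum_x (n (x, true) + n (x, false)))%N.
  rewrite -sum1_card big_mkcond /=.
  rewrite (eq_bigr (fun p : X * bool => n (p.1, p.2) : nat)); last first.
    by move=> [z r] _; rewrite inE; case: (n _).
  rewrite -(pair_big xpredT xpredT (fun z r => n (z, r) : nat)) /=.
  by apply: eq_bigr => z _; rewrite big_bool.
rewrite -{1}hf cardE -big_split /= /doublons -sum1_card -big_split /=.
apply: eq_bigr => z _; rewrite /hole /doublon.
by case: (n _); case: (n _).
Qed.

Definition neel_fconfig (up : bool) : F := [ffun p => neel up p.1 == p.2].

Lemma neel_half_filled up : half_filled (neel_fconfig up).
Proof.
rewrite /half_filled; apply/eqP.
have inj : injective (fun x : X => (x, neel up x)) by move=> x y [].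
rewrite -[RHS](card_imset predT inj).
apply: eq_card => p; rewrite inE ffunE; apply/eqP/imsetP => [e|[x _ ->]//].
by exists p.1 => //; rewrite e -surjective_pairing.
Qed.

Lemma doublons_neel up : doublons (neel_fconfig up) = 0%N.
Proof.
by apply: big1 => x _; rewrite /doublon !ffunE /=; case: (neel up x).
Qed.

End FermionConfigurations.

(** * Hubbard operators in the occupation basis *)

Section HubbardOperators.
Variables (R : realType) (L d : nat).
Local Open Scope complex_scope.
Local Notation C := R[i].
Local Notation X := (site L d).
Local Notation F := (fconfig L d).
Implicit Types (n : F) (p q : mode L d) (x y : X) (s : bool).

Definition jwsign n p : C :=
  (-1) ^+ #|[set q : mode L d | (enum_rank q < enum_rank p)%N && n q]%SET|.

Lemma conjc_jwsign n p : conjc (jwsign n p) = jwsign n p.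
Proof. by rewrite rmorphXn rmorphN rmorph1. Qed.

Lemma entry_ann p n' n :
  entry (ann R p) n' n = if n p && (n' == clear p n) then jwsign n p else 0.
Proof. exact: entry_op_of. Qed.

Lemma entry_hop p q n' n : entry (cre R p *m ann R q) n' n =
  if [&& n' p, n q & clear p n' == clear q n] then jwsign n' p * jwsign n q else 0.
Proof.
rewrite entryM (bigD1 (clear p n')) //= big1 ?addr0; last first.
  by move=> m /negPf mc; rewrite entry_adjoint entry_ann mc andbF conjc0 mul0r.
rewrite entry_adjoint !entry_ann eqxx andbT.
case: (n' p); last by rewrite conjc0 mul0r.
by rewrite conjc_jwsign /=; case: ifP => _ //; rewrite mulr0.
Qed.

Lemma numopE p : numop R p = diagop (fun n => (n p)%:R).
Proof.
apply: entry_inj => n' n; rewrite entry_hop entry_diagop.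
have [->|ne] := eqVneq n' n.
  rewrite eqxx andbT andbb; case: (n p) => //.
  by rewrite /jwsign -expr2 sqrr_sign.
by case: ifP => // /and3P[n'p np]; rewrite clear_inj // (negPf ne).
Qed.

Lemma DopE : Dop R L d = diagop (fun n => (doublons n)%:R).
Proof.
rewrite /Dop; under eq_bigr do rewrite !numopE diagopM.
rewrite diagop_sum; congr diagop; apply/funext => n.
by rewrite natr_sum; apply: eq_bigr => x _; rewrite -natrM mulnb.
Qed.

Definition stagM n : R :=
  \sum_x Defs.eta R x * (1 / 2 * ((n (x, true))%:R - (n (x, false))%:R)).

Lemma MopE : Mop R L d = diagop stagM.
Proof.
rewrite -diagop_sum; apply: eq_bigr => x _.
by rewrite etaC /S3f !numopE diagopB !diagopZ.
Qed.

Lemma norm_stagM n : `|stagM n| <= #|X|%:R / 2.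
Proof.
apply: norm_staggered_sum => x.
by case: (n _); case: (n _); rewrite ler_norml /= ?mulr1n ?mulr0n; apply/andP; split; lra.
Qed.

(** The sum runs over ordered pairs: the two mutually adjoint terms of a bond come from its two
    orderings. *)
Definition hopping : opB R F :=
  \sum_x \sum_(y | Defs.adjacent x y) \sum_(s : bool)
    (cre R (x, s) *m ann R (y, s)).

Lemma TopE (t : R) : Top L d t = (- t)%:C *: hopping.
Proof.
rewrite /Top /hopping -bond_sum_pairs; congr (_ *: _).
by rewrite !bond_sumE; do 2![apply: eq_bigr => ? _]; rewrite big_split.
Qed.

Lemma adjoint_hopping : adjoint hopping = hopping.
Proof.
rewrite /hopping adjoint_sum.
transitivity (\sum_(x : X) \sum_(y | Defs.adjacent x y) \sum_(s : bool)
    (cre R (y, s) *m ann R (x, s))).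
  do 3![apply: eq_bigr => ? _; rewrite ?adjoint_sum].
  by rewrite adjointM adjointK.
under eq_bigr do rewrite big_mkcond.
rewrite exchange_big; apply: eq_bigr => x _; rewrite [RHS]big_mkcond.
by apply: eq_bigr => y _; rewrite adjacent_sym.
Qed.

(** A hop always changes the configuration, so hopping does not affect the diagonal energy of a Neel
    configuration. *)
Lemma entry_hopping_diag n : entry hopping n n = 0.
Proof.
rewrite /hopping entry_sum big1 // => x _; rewrite entry_sum big1 // => y xy.
rewrite entry_sum big1 // => s _; rewrite entry_hop; case: ifP => // /and3P[nx _ /eqP e].
have ne : (x, s) != (y, s).
  by apply: contraTneq xy => -[->]; exact: adjacent_irr.
by have [] := clear_eq_move ne nx e; rewrite nx.
Qed.

(** * Hopping against weights decaying with the number of doublons *)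

Section Weights.
Variables (a : R).
Hypotheses (a0 : 0 < a) (a1 : a <= 1).

Definition weight n : R := a ^+ doublons n.

Lemma weight_gt0 n : 0 < weight n. Proof. exact: exprn_gt0. Qed.

(** By [doublons_move] the ratio of weights is [a], [1] or [a^-1] according as none, one or both of
    the indicators hold. The bound is made linear in the indicators so that it can be summed over
    the bonds. *)
Lemma weight_move x y s n : x != y -> n (y, s) -> ~~ n (x, s) ->
  weight (move (x, s) (y, s) n) <=
  (a + a^-1 * ((doublon n y)%:R + (hole n x)%:R)) * weight n.
Proof.
move=> xy ny nx; have := doublons_move xy ny nx.
rewrite /weight; set D' := doublons (move _ _ _); set D := doublons n.
have w0 k : 0 < a ^+ k by exact: exprn_gt0.
have ai1 : 1 <= a^-1 by rewrite invf_ge1.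
case: (doublon n y); case: (hole n x) => /= e.
- have -> : D = D'.+1 by lia.
  have -> : (a + a^-1 * (1%:R + 1%:R)) * a ^+ D'.+1 = (a * a + 2) * a ^+ D'.
    rewrite exprS mulrA; congr (_ * _).
    by rewrite mulrDl [_ * a in X in _ + X]mulrAC mulVf ?gt_eqF // mul1r.
  rewrite ler_peMl ?ltW //; have : 0 < a * a by rewrite mulr_gt0.
  lra.
- have -> : D = D' by lia.
  by rewrite ler_peMl ?ltW //= mulr1n mulr0n ?addr0 ?add0r ?mulr1 ltr_pwDl.
- have -> : D = D' by lia.
  by rewrite ler_peMl ?ltW //= mulr1n mulr0n ?addr0 ?add0r ?mulr1 ltr_pwDl.
have -> : D' = D.+1 by lia.
by rewrite exprS addr0 mulr0 addr0.
Qed.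

Lemma colsum_hop x y s n : x != y ->
  colsum weight (cre R (x, s) *m ann R (y, s)) n <=
  (a + a^-1 * ((doublon n y)%:R + (hole n x)%:R)) * weight n.
Proof.
move=> xy; have ne : (x, s) != (y, s) by rewrite xpair_eqE eqxx andbT.
set c := _ * weight n.
have c0 : 0 <= c.
  by rewrite mulr_ge0 ?addr_ge0 ?mulr_ge0 ?invr_ge0 ?addr_ge0 ?ler0n // ltW // weight_gt0.
rewrite /colsum (bigD1 (move (x, s) (y, s) n)) //= big1 ?addr0; last first.
  move=> m mne; rewrite entry_hop; case: ifP => [/and3P[mx ny /eqP e]|]; last first.
    by rewrite cabs0 mul0r.
  by have [_ em] := clear_eq_move ne mx e; rewrite em eqxx in mne.
rewrite entry_hop; case: ifP => [/and3P[mx ny /eqP e]|]; last by rewrite cabs0 mul0r.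
have [nx _] := clear_eq_move ne mx e.
by rewrite cabsM !cabs_sign !mul1r; exact: weight_move.
Qed.

(** Two spins and at most [2 * d] neighbours give the factor [4 * d]; the factor 2 appears because
    half filling turns the number of holes into the number of doublons. *)
Lemma colsum_hopping n : half_filled n ->
  colsum weight hopping n <=
  4 * d%:R * (a * #|X|%:R + 2 * a^-1 * (doublons n)%:R) * weight n.
Proof.
move=> hf; have w0 m : 0 <= weight m by rewrite ltW // weight_gt0.
have ai0 : 0 <= a^-1 by rewrite invr_ge0 ltW.
(* The bound on a hop is split into a function of [x] and a function of [y], with [a] shared
   equally, so that each part is summed by counting neighbours. *)
pose G x := (a / 2 + a^-1 * (hole n x)%:R) * weight n.
pose K y := (a / 2 + a^-1 * (doublon n y)%:R) * weight n.
have G0 x : 0 <= G x by rewrite mulr_ge0 // addr_ge0 // ?mulr_ge0 ?invr_ge0 ?ler0n // ltW.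
have K0 x : 0 <= K x by rewrite mulr_ge0 // addr_ge0 // ?mulr_ge0 ?invr_ge0 ?ler0n // ltW.
apply: le_trans (colsum_sum _ _ _ _ w0) _.
apply: le_trans (_ : \sum_x \sum_(y | Defs.adjacent x y) 2 * (G x + K y) <= _).
  apply: ler_sum => x _; apply: le_trans (colsum_sum _ _ _ _ w0) _.
  apply: ler_sum => y xy; apply: le_trans (colsum_sum _ _ _ _ w0) _.
  rewrite big_bool mulr_natl mulr2n.
  have ne : x != y by apply: contraTneq xy => ->; exact: adjacent_irr.
  have -> : G x + K y =
     (a + a^-1 * ((doublon n y)%:R + (hole n x)%:R)) * weight n.
    by rewrite /G /K; field; rewrite gt_eqF.
  by apply: lerD; exact: colsum_hop.
under eq_bigr do rewrite -mulr_sumr big_split.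
rewrite -mulr_sumr big_split.
have sG : \sum_x G x = (a / 2 * #|X|%:R + a^-1 * (doublons n)%:R) * weight n.
  rewrite -mulr_suml big_split /= sumr_const -[_ *+ #|_|]mulr_natr.
  by rewrite -mulr_sumr -natr_sum half_filled_holes.
have sK : \sum_x K x = (a / 2 * #|X|%:R + a^-1 * (doublons n)%:R) * weight n.
  rewrite -mulr_suml big_split /= sumr_const -[_ *+ #|_|]mulr_natr.
  by rewrite -mulr_sumr -natr_sum.
have hG := sum_adjacent_l G0; have hK := sum_adjacent_r K0.
apply: le_trans (ler_wpM2l _ (lerD hG hK)) _ => //; rewrite sG sK.
rewrite le_eqVlt; apply/orP; left; apply/eqP.
by move: a^-1 (#|X|%:R : R) ((doublons n)%:R : R) (weight n) => ai N D w; field.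
Qed.

End Weights.
End HubbardOperators.

(** * The Hubbard pressure at half filling *)

Section HubbardPressure.
Variables (R : realType) (L d : nat).
Local Open Scope complex_scope.
Local Notation X := (site L d).
Local Notation F := (fconfig L d).
Local Notation HF := (hfconfig L d).

Definition hf_hopping : opB R HF :=
  op_of (fun n' n : HF => entry (hopping R L d) (val n') (val n)).

Lemma H_HubE (t U h : R) : H_Hub L d t U h =
  diagop (fun n : HF => U * (doublons (val n))%:R - h * stagM R (val n))
  + (- t)%:C *: hf_hopping.
Proof.
apply: entry_inj => n' n; rewrite entry_op_of /H_Hub_full DopE MopE TopE !diagopZ.
rewrite !entryD entryN !entryZ !entry_diagop entry_op_of.
rewrite addrAC (inj_eq val_inj); congr (_ + _).
by case: eqP => _; [rewrite rmorphB | rewrite subr0].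
Qed.

Lemma adjoint_hf_hopping : adjoint hf_hopping = hf_hopping.
Proof.
apply: adjoint_entry => n' n; rewrite !entry_op_of.
by rewrite -[in RHS]adjoint_hopping entry_adjoint.
Qed.

(** Restricting to the sector only drops nonnegative terms. *)
Lemma colsum_hf_hopping (w : F -> R) (n : HF) : (forall m, 0 <= w m) ->
  colsum (fun m : HF => w (val m)) hf_hopping n <= colsum w (hopping R L d) (val n).
Proof.
move=> w0; pose f (m : F) := cabs (entry (hopping R L d) m (val n)) * w m.
rewrite /colsum; under eq_bigr do rewrite entry_op_of.
rewrite -(big_sub (fun m : F => half_filled m) f) /= big_mkcond /=.
apply: ler_sum => m _; rewrite /f; case: ifP => _ //.
by rewrite mulr_ge0 ?cabs_ge0.
Qed.

Lemma p_Hub_estimate (t U h beta : R) : 0 < beta -> 0 < U -> t != 0 ->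
  (0 < d)%N -> 8 * d%:R * `|t| <= U ->
  `| p_Hub L d t beta U h - `|h| / 2 | <= 32 * d%:R ^+ 2 * t ^+ 2 / U + 3 / beta.
Proof.
move=> b0 U0 t0 d0 tU.
have d0' : 0 < d%:R :> R by rewrite ltr0n.
have nt0 : 0 < `|t| by rewrite normr_gt0.
(* This value makes the coefficient [8 * d * |t| / a] of the doublon number equal to [U], so it
   cancels the repulsion exactly; the remaining term is [32 * d^2 * t^2 / U] per site. The
   hypothesis on [U] says that [a <= 1]. *)
pose a := 8 * d%:R * `|t| / U.
have a0 : 0 < a by rewrite divr_gt0 // !mulr_gt0.
have a1 : a <= 1 by rewrite ler_pdivrMr // mul1r.
have hM (n : F) : `|h * stagM R n| <= `|h| / 2 * #|X|%:R.
  rewrite normrM mulrAC -mulrA ler_wpM2l //; exact: norm_stagM.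
pose n0 : HF := exist (fun n : F => half_filled n) _ (neel_half_filled L d (0 <= h)).
apply: (@pressure_estimate _ _ _ n0).
- exact: card_site_gt0.
- by [].
- rewrite card_sig; apply: leq_trans (max_card _) _.
  by rewrite card_ffun card_prod card_bool mulnC expnM.
- by rewrite H_HubE adjointD adjointZ adjoint_diagop adjoint_hf_hopping.
- rewrite H_HubE entryD entryZ ReD Re_realM entry_diagop eqxx Re_real.
  rewrite entry_op_of /= entry_hopping_diag doublons_neel /= mulr0 mulr0 addr0 sub0r.
  rewrite (@field_energy_neel _ _ _ h); last first.
    by move=> x; rewrite !ffunE /=; case: (neel _ x); rewrite /= ?mulr1n ?mulr0n; lra.
  have : 0 <= 32 * d%:R ^+ 2 * t ^+ 2 / U * #|X|%:R.
    by rewrite mulr_ge0 ?ler0n // divr_ge0 ?(ltW U0) // mulr_ge0 ?sqr_ge0 // mulr_ge0 ?sqr_ge0.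
  move: (32 * d%:R ^+ 2 * t ^+ 2 / U) => delta; lra.
move=> lam v v0; rewrite H_HubE => vlam.
apply: (weighted_gershgorin (w := fun n : HF => weight a (val n)) _ _ v0 vlam).
  by move=> n; exact: weight_gt0.
move=> n; have w0 := weight_gt0 a0 (val n).
have := colsumZ (fun m : HF => weight a (val m)) (- t) hf_hopping n.
rewrite {1}/colsum => ->; rewrite normrN.
have := colsum_hf_hopping n (fun m => ltW (weight_gt0 a0 m)).
move=> /le_trans /(_ (colsum_hopping a0 a1 (valP n))).
move=> /(ler_wpM2l (ltW nt0)) /le_trans; apply.
rewrite mulrA ler_wpM2r //; first exact: ltW.
have -> : `|t| * (4 * d%:R * (a * #|X|%:R + 2 * a^-1 * (doublons (val n))%:R))
  = U * (doublons (val n))%:R + 32 * d%:R ^+ 2 * `|t| ^+ 2 / U * #|X|%:R.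
  rewrite /a; move: (#|X|%:R : R) ((doublons (val n))%:R : R) => N D.
  move: nt0 d0' U0; move: (`|t|) (d%:R : R) => u e u0 e0 U0.
  by field; rewrite ?gt_eqF.
have := hM (val n); rewrite ler_norml real_normK ?num_real // => /andP[_].
move: (32 * d%:R ^+ 2 * t ^+ 2 / U) => delta; lra.
Qed.

End HubbardPressure.

(** * Comparison of the two pressures *)

Unset Implicit Arguments.

Theorem theorem1p1 (R : realType) (d : nat) (t l0 h0 : R) :
  (1 <= d)%N -> t != 0 -> 0 < l0 -> 0 < h0 ->
  exists (U0 : R) (eps_FE : R -> R -> R),
    (forall U beta : R, 0 <= eps_FE U beta) /\
    (forall (U beta : R) (L : nat) (h : R),
        U0 <= U -> 0 < beta -> l0 <= beta * J0 t U ->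
        (0 < L)%N -> ~~ odd L -> `|h| <= h0 ->
        `| p_Hub L d t beta U h - p_Heis L d t beta U h | <= eps_FE U beta) /\
    (ereal_sup [set (eps_FE U beta)%:E | beta in
                  [set beta : R | 0 < beta /\ l0 <= beta * J0 t U]]
       @[U --> +oo] --> (0 : \bar R)%E).
Proof.
move=> d0 t0 l0_gt0 _.
have d0' : 0 < d%:R :> R by rewrite ltr0n.
have t2 : 0 < t ^+ 2 by rewrite exprn_even_gt0.
have J_gt0 U : 0 < U -> 0 < J0 t U.
  by move=> U0; rewrite divr_gt0 // mulr_gt0.
(* [U] times the total error: the Hubbard term, the Heisenberg term [2 * d * J0 t U], and two
   contributions [3 / beta], each at most [3 * J0 t U / l0]. *)
pose K : R := 32 * d%:R ^+ 2 * t ^+ 2 + 8 * d%:R * t ^+ 2 + 24 * t ^+ 2 / l0.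
have K0 : 0 < K.
  apply: addr_gt0; last by rewrite divr_gt0 // mulr_gt0.
  by apply: addr_gt0; rewrite mulr_gt0 // mulr_gt0 // exprn_gt0.
(* The threshold is the one of [p_Hub_estimate]. The modulus of [U] keeps the error nonnegative for
   every real [U], and the error is constant in [beta]. *)
exists (8 * d%:R * `|t|), (fun U _ => K / `|U|); split; last split.
- by move=> U _; rewrite divr_ge0 // ltW.
- move=> U beta L h tU b0 bJ _ _ _.
  have U0 : 0 < U by apply: lt_le_trans tU; rewrite !mulr_gt0 ?normr_gt0.
  have hub := p_Hub_estimate L h b0 U0 t0 d0 tU.
  have heis := p_Heis_estimate L d h b0 (ltW (J_gt0 U U0)).
  have bi : beta^-1 <= 4 * t ^+ 2 / l0 / U.
    rewrite mulrAC ler_pdivlMr // mulrC ler_pdivrMr // mulrC; exact: bJ.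
  rewrite (gtr0_norm U0).
  have -> : K / U = (32 * d%:R ^+ 2 * t ^+ 2 / U + 3 * (4 * t ^+ 2 / l0 / U))
     (* The two brackets are the errors of the Hubbard and the Heisenberg estimate relative to the
        common value |h|/2. *)
     + (2 * d%:R * J0 t U + 3 * (4 * t ^+ 2 / l0 / U)).
    by rewrite /K /J0; move: (d%:R : R) => D; field; rewrite !gt_eqF.
  rewrite -[_ - _](subrKA (`|h| / 2)) -[X in _ + X]opprB.
  apply: le_trans (ler_normB _ _) _.
  apply: lerD; [apply: le_trans hub _|apply: le_trans heis _]; rewrite lerD2l;
    by rewrite ler_wpM2l.
have KU : (K / `|U|)%:E @[U --> +oo] --> (0 : \bar R)%E.
  apply: cvg_EFin; first by near=> U.
  apply/cvgr0Pnorm_le => e e0; near=> U => /=.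
  have KeU : K / e <= U by near: U; apply: nbhs_pinfty_ge; exact: num_real.
  have U0 : 0 < U by near: U; exact: nbhs_pinfty_gt.
  rewrite (gtr0_norm U0) gtr0_norm ?divr_gt0 // ler_pdivrMr //.
  by rewrite mulrC -ler_pdivrMr.
apply: cvg_trans KU; apply: near_eq_cvg; near=> U.
have U0 : 0 < U by near: U; exact: nbhs_pinfty_gt.
(* The supremum is that of a singleton once some [beta] is admissible; over an empty set it would be
   minus infinity. The witness [l0 / J0 t U] meets the constraint with equality. *)
rewrite (_ : [set _ | _ in _] = [set (K / `|U|)%:E]) ?ereal_sup1 //.
apply/seteqP; split => [_ [beta _ <-]//|_ ->].
exists (l0 / J0 t U) => //; split.
  by rewrite divr_gt0 // J_gt0.
by rewrite divfK // gt_eqF // J_gt0.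
Unshelve. all: by end_near.
Qed.
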